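(* Let $X$ be an infinite transitive subshift over a finite alphabet $\mathcal{A}$. Then for every integer $n \geq 1$, $$\left|\mathrm{Aut}_{\lfloor (n-1)/2 \rfloor}(X, \sigma)\right| \leq \left(c_{1+c_n(X)}(X)\right)^{2|\mathcal{A}| (c_{n+1}(X) - c_n(X))}.$$
   Context: The full shift $\mathcal{A}^{\mathbb{Z}}$ carries the product topology of the discrete topology, and the left shift $\sigma$ is defined by $(\sigma x)(n) = x(n+1)$. A subshift over $\mathcal{A}$ is a closed subset $X \subset \mathcal{A}^{\mathbb{Z}}$ invariant under $\sigma$ (i.e. $\sigma(X)=X$). The language $L(X)$ is the set of all finite words occurring as subwords (blocks of consecutive letters) of points of $X$; $L_n(X) = L(X)\cap \mathcal{A}^n$; and $c_n(X) = |L_n(X)|$. $X$ is (topologically) transitive if there exists $x \in X$ with $X = \overline{\{\sigma^n x : n \in \mathbb{Z}\}}$. An automorphism of $X$ is a homeomorphism $\phi: X \to X$ with $\phi\circ\sigma = \sigma\circ\phi$. For an integer $N \ge 0$, an automorphism $\phi$ has range $N$ if there is a map $\Phi: \mathcal{A}^{2N+1} \to \mathcal{A}$ with $(\phi x)(i) = \Phi(x(i-N) x(i-N+1)\cdots x(i+N))$ for all $x \in X$ and $i \in \mathbb{Z}$ (the range is not unique; $N$ need not be minimal). $\mathrm{Aut}_N(X,\sigma)$ is the set of automorphisms of $X$ which have range $N$. *)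

(* Defs.v *)
From HB Require Import structures.
From mathcomp Require Import all_boot all_order all_algebra.
From mathcomp Require Import all_classical.
From mathcomp Require Import topology.

Set Implicit Arguments.
Unset Strict Implicit.
Unset Printing Implicit Defensive.

Import GRing.Theory.

Local Open Scope classical_set_scope.
Local Open Scope ring_scope.

Notation full_shift A := (prod_topology (fun _ : int => discrete_topology A)).

Section Shift.
Variable A : finType.
Implicit Types (x : full_shift A) (i k : int) (n N : nat).

Definition shift x : full_shift A := fun i => x (i + 1).

(* The k-th iterate of the shift for an integer k, in closed form; the two
   lemmas below determine it, since the shift is a bijection. *)
Definition shiftz k x : full_shift A := fun i => x (i + k).

Lemma shiftz0 x : shiftz 0 x = x.
Proof. by apply/funext => i; rewrite /shiftz addr0. Qed.

Lemma shiftzD1 k x : shiftz (k + 1) x = shift (shiftz k x).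
Proof. by apply/funext => i; rewrite /shift /shiftz addrAC addrA. Qed.

Definition shift_orbit x : set (full_shift A) := range (fun k => shiftz k x).

Definition block x i n : n.-tuple A := [tuple x (i + (k : nat)%:Z) | k < n].

Record subshift := Subshift {
  points :> set (full_shift A);
  subshift_closed : closed points;
  subshift_invariant : shift @` points = points
}.

Implicit Type X : subshift.

Definition topologically_transitive X : Prop :=
  exists2 x, points X x & points X = closure (shift_orbit x).

Definition language X : set (seq A) :=
  [set w | exists x i, points X x /\ w = block x i (size w)].

Definition words X n : {set n.-tuple A} :=
  [set w : n.-tuple A | `[< language X w >]].

(* Nondecreasing in n, since every word of X extends to the right: truncated
   differences of consecutive values are the usual ones. *)
Definition complexity X n : nat := #|words X n|.

Lemma shift_mem X (x : X) : shift (val x) \in points X.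
Proof.
by apply/mem_set; rewrite -[X in X _]subshift_invariant; exists (val x);
  [exact: set_valP|].
Qed.

Definition shift_on X (x : X) : X := exist _ (shift (val x)) (shift_mem x).

(* The type X carries the subspace topology induced by the full shift. *)
Definition homeomorphism X (phi : X -> X) : Prop :=
  exists psi : X -> X,
    [/\ cancel phi psi, cancel psi phi, continuous phi & continuous psi].

Definition automorphism X (phi : X -> X) : Prop :=
  homeomorphism phi /\ phi \o @shift_on X = @shift_on X \o phi.

Definition has_range X N (phi : X -> X) : Prop :=
  exists Phi : (2 * N + 1)%N.-tuple A -> A, forall (x : X) i,
    val (phi x) i = Phi (block (val x) (i - N%:Z) (2 * N + 1)%N).

(* Maps of the subtype X, so equality of elements is equality on X only and
   the cardinality does not count values outside X. *)
Definition AutN X N : set (X -> X) :=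
  [set phi | automorphism phi /\ has_range N phi].

End Shift.

Arguments AutN {A} X N _.

(* Main.v *)
(** A block map whose window fits in [n] letters is determined by its output
    along one transitive point [x0], and the output at a position depends only on
    the length-[n] word read there. Follow the path of [x0] in the Rauzy graph,
    whose vertices are the [n]-words of [X] and whose edges are its [(n+1)]-words.
    After an edge leaving a right-special word the path is forced until the next
    right-special word, so it visits every vertex of that stretch within
    [c_n + 1] steps: one output word of length [1 + c_n] per such edge settles all
    positions having a right-special word to their left. The mirror image settles
    those having a left-special word to their right. A word none of whose
    occurrences is settled recurs arbitrarily far to the right, so [x0] meets no
    right-special word and is periodic, which is impossible as [X] is infinite.
    There are at most [2 (c_{n+1} - c_n)] edges of each kind, and [2 <= #|A|]. *)

Require Import Defs.
From mathcomp Require Import all_boot all_order all_algebra.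
From mathcomp Require Import all_classical.
From mathcomp Require Import topology.
From mathcomp Require Import zify.

Set Implicit Arguments.
Unset Strict Implicit.
Unset Printing Implicit Defensive.

Import GRing.Theory.

Local Open Scope ring_scope.

(** * Bi-infinite paths in a finite graph and their branching edges *)

Section Itinerary.
Variable V : finType.
Implicit Types (u : int -> V) (p : V * V).

Definition verts u : {set V} := [set v | `[< exists i, u i = v >]].

Definition step u (i : int) := (u i, u (i + 1)).

Definition edges u : {set V * V} := [set p | `[< exists i, step u i = p >]].

(* For [u i = block x i n], the edges leaving right-special words; for
   [reverse u], those entering left-special words. *)
Definition branching u : {set V * V} :=
  [set p in edges u | (1 < #|[set q in edges u | q.1 == p.1]|)%N].

Definition reverse u : int -> V := fun i => u (- i).

Lemma verts_mem u i : u i \in verts u.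
Proof. by rewrite inE; apply/asboolP; exists i. Qed.

Lemma edges_mem u i : step u i \in edges u.
Proof. by rewrite inE; apply/asboolP; exists i. Qed.

Lemma reverseK u : reverse (reverse u) = u.
Proof. by apply/funext => i; rewrite /reverse opprK. Qed.

Lemma verts_reverse u : verts (reverse u) = verts u.
Proof.
by apply/setP => v; rewrite !inE; apply/asboolP/asboolP => -[i <-]; exists (- i);
  rewrite /reverse ?opprK.
Qed.

Lemma card_edges_reverse u : #|edges (reverse u)| = #|edges u|.
Proof.
pose sw (p : V * V) := (p.2, p.1).
have sw_inj : injective sw by move=> [a b] [c d] [-> ->].
suff le_rev w : (#|edges (reverse w)| <= #|edges w|)%N.
  by apply/eqP; rewrite eqn_leq le_rev -{1}[u]reverseK le_rev.
rewrite -(card_imset _ sw_inj); apply/subset_leq_card/fintype.subsetP => p.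
case/imsetP => q; rewrite inE => /asboolP[i <-] ->.
rewrite inE; apply/asboolP; exists (- (i + 1)).
by rewrite /step /sw /reverse /=; congr (w _, w _); lia.
Qed.

(* A vertex of out-degree [d] contributes [d - 1] to [#|edges| - #|verts|],
   and [d <= 2 (d - 1)] as soon as [d >= 2]. *)
Lemma card_branching u : (#|branching u| <= 2 * (#|edges u| - #|verts u|))%N.
Proof.
pose d v := #|[set q in edges u | q.1 == v]|.
have degE : #|edges u| = (\sum_(v in verts u) d v)%N.
  rewrite -sum1_card (partition_big fst (mem (verts u))) /=; last first.
    by move=> p; rewrite inE => /asboolP[i <-]; exact: verts_mem.
  by apply: eq_bigr => v _; rewrite /d -sum1_card; apply: eq_bigl => p; rewrite inE.
have d_gt0 v : v \in verts u -> (0 < d v)%N.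
  rewrite inE => /asboolP[i <-]; apply/card_gt0P; exists (step u i).
  by rewrite inE edges_mem /=.
have -> : (#|edges u| - #|verts u| = \sum_(v in verts u) (d v).-1)%N.
  apply/eqP; rewrite -(eqn_add2r #|verts u|) subnK.
    rewrite degE -sum1_card -big_split /=; apply/eqP/eq_bigr => v vV.
    by rewrite addn1 prednK ?d_gt0.
  by rewrite degE -sum1_card; apply: leq_sum => v; exact: d_gt0.
rewrite big_distrr -sum1_card (partition_big fst (mem (verts u))) /=; last first.
  by move=> p; rewrite inE => /andP[+ _]; rewrite inE => /asboolP[i <-]; exact: verts_mem.
apply: leq_sum => v vV.
have [d1|d2] := leqP (d v) 1.
  rewrite big_pred0 // => p; apply/negbTE/negP; rewrite inE => /andP[/andP[_ +] /eqP pv].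
  by rewrite pv -/(d v) ltnNge d1.
apply: (@leq_trans (d v)); last by move: d2; clear; lia.
rewrite sum1_card; apply/subset_leq_card/fintype.subsetP => p.
by rewrite -topredE /= !inE => /andP[/andP[-> _] ->].
Qed.

Lemma repetition u i :
  exists a b : nat, [/\ (a < b)%N, (b <= #|verts u|)%N & u (i + a%:Z) = u (i + b%:Z)].
Proof.
pose f (k : 'I_#|verts u|.+1) := u (i + k%:Z).
have /injectiveP : ~ injective f.
  move=> /card_codom fI.
  suff : (#|'I_#|verts u|.+1| <= #|verts u|)%N by rewrite card_ord ltnn.
  rewrite -fI; apply/subset_leq_card/fintype.subsetP => _ /codomP[k ->]; exact: verts_mem.
move=> /injectivePn[a [b ab fab]].
have [ltab|ltba|/val_inj/eqP] := ltngtP a b; last by rewrite (negbTE ab).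
  by exists a, b; split=> //; rewrite -ltnS.
by exists b, a; split=> //; rewrite -ltnS.
Qed.

Lemma not_branching_det u i j :
  step u i \notin branching u -> u j = u i -> u (j + 1) = u (i + 1).
Proof.
rewrite inE edges_mem /= -leqNgt => /fintype.card_le1_eqP le1 uij.
have [] // : step u j = step u i.
  by apply: le1; rewrite inE edges_mem /= ?uij.
Qed.

Lemma not_branching_follow u i j t :
  (forall s, (s < t)%N -> step u (i + s%:Z) \notin branching u) ->
  u j = u i -> u (j + t%:Z) = u (i + t%:Z).
Proof.
elim: t => [|t IHt] nb uji; first by rewrite !addr0.
have E (k : int) : k + t.+1%:Z = k + t%:Z + 1 by lia.
rewrite !E; apply: not_branching_det; first exact: nb.
by apply: IHt => // s st; apply: nb; rewrite ltnS ltnW.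
Qed.

Lemma reach_from_branching u (k : V * V -> int) :
  {in branching u, forall p, step u (k p) = p} ->
  forall t j, step u j \in branching u ->
  exists2 p, p \in branching u &
    exists2 s, (s <= #|verts u|)%N & u (j + t%:Z) = u (k p + s%:Z).
Proof.
move=> kP; elim/ltn_ind => t IHt j jB.
have [/existsP[s /andP[s0 sB]]|/existsPn nB] :=
    boolP [exists s : 'I_t, (0 < s)%N && (step u (j + s%:Z) \in branching u)].
  have st := ltn_ord s.
  have [|p pB [r rV e]] := IHt (t - s)%N _ _ sB; first lia.
  exists p => //; exists r => //; rewrite -e; congr u; lia.
have {}nB s : (0 < s)%N -> (s < t)%N -> step u (j + s%:Z) \notin branching u.
  by move=> s0 st; have := nB (Ordinal st); rewrite s0.
have [tV|Vt] := leqP t #|verts u|.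
  exists (step u j) => //; exists t => //.
  have [e0 e1] := kP _ jB.
  case: t tV nB {IHt} => [|t] tV nB; first by rewrite !addr0.
  have E (i : int) : i + t.+1%:Z = i + 1 + t%:Z by lia.
  rewrite !E; apply/esym/not_branching_follow => // s st.
  have -> : j + 1 + s%:Z = j + s.+1%:Z by lia.
  exact: nB.
(* The search starts at [j + 1] because the edge at [j] itself branches; cutting the cycle shortens
   [t] by [b - a]. *)
have [a [b [ab bV e]]] := repetition u (j + 1).
have [|p pB [s sV us]] := IHt (t - (b - a))%N _ _ jB; first lia.
exists p => //; exists s => //; rewrite -us.
have -> : j + (t - (b - a))%N%:Z = j + 1 + a%:Z + (t - b.+1)%N%:Z by lia.
have -> : j + t%:Z = j + 1 + b%:Z + (t - b.+1)%N%:Z by lia.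
apply/esym/not_branching_follow => // r rt.
have -> : j + 1 + b%:Z + r%:Z = j + (b + r).+1%:Z by lia.
by apply: nB; lia.
Qed.

(** Without branching edges, a repeated vertex repeats its whole future. *)
Lemma no_branching_periodic u :
  branching u = finset.set0 -> exists2 P, (0 < P)%N & forall i, u (i + P%:Z) = u i.
Proof.
move=> B0.
(* The period [d] found below depends on [i] but is at most [#|verts u|], so it divides this
   factorial. *)
exists (#|verts u|)`!%N; first exact: fact_gt0.
(* Searching from this far left puts the first of the two equal vertices at or before [i]. *)
move=> i; have [a [b [ab bV e]]] := repetition u (i - #|verts u|%:Z).
pose d := (b - a)%N.
have per j : i <= j -> u (j + d%:Z) = u j.
  move=> ij; set l := i - #|verts u|%:Z in e.
  have -> : j = l + a%:Z + `|(j - (l + a%:Z))%R|%N%:Z by rewrite /l; lia.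
  have -> : l + a%:Z + `|(j - (l + a%:Z))%R|%N%:Z + d%:Z
     = l + b%:Z + `|(j - (l + a%:Z))%R|%N%:Z by rewrite /l /d; lia.
  by apply: not_branching_follow => // s _; rewrite B0 inE.
have perM m : u (i + (m * d)%N%:Z) = u i.
  elim: m => [|m IHm]; first by rewrite mul0n addr0.
  rewrite mulSn -{}IHm -[RHS]per; last lia.
  by congr u; lia.
have /divnK <- : (d %| (#|verts u|)`!)%N.
  by apply: dvdn_fact; rewrite /d; lia.
exact: perM.
Qed.

(* If both alternatives fail, no occurrence of [u i] has a branching edge to its
   left or a reversed one to its right. Determinism towards the left then makes
   [u i] recur arbitrarily far to the right, so there are no branching edges. *)
Lemma reach_from_either u (k l : V * V -> int) :
  {in branching u, forall p, step u (k p) = p} ->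
  {in branching (reverse u), forall p, step (reverse u) (l p) = p} ->
  ~ (exists2 P, (0 < P)%N & forall i, u (i + P%:Z) = u i) ->
  forall i,
  (exists2 p, p \in branching u &
     exists2 s, (s <= #|verts u|)%N & u i = u (k p + s%:Z)) \/
  (exists2 p, p \in branching (reverse u) &
     exists2 s, (s <= #|verts u|)%N & u i = u (- (l p + s%:Z))).
Proof.
move=> kP lP nper i; apply: contrapT => /not_orP[nk nl]; apply: nper.
apply: no_branching_periodic; apply/eqP/finset.set0Pn => -[p pB].
have nB h j : u h = u i -> j <= h -> step u j \notin branching u.
  move=> uh jh; apply/negP => jB; apply: nk; rewrite -uh.
  have -> : h = j + `|h - j|%N%:Z by lia.
  exact: reach_from_branching.
have nB' j : j <= - i -> step (reverse u) j \notin branching (reverse u).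
  move=> ji; apply/negP => jB; apply: nl; rewrite -verts_reverse.
  have -> : u i = reverse u (j + `|- i - j|%N%:Z) by rewrite /reverse; congr u; lia.
  exact: reach_from_branching.
(* A vertex repeated at [h + a] and [h + b] has a forced past: going back [a] steps from both gives
   equal vertices at [h] and [h + (b - a)]. *)
have rec h : i <= h -> u h = u i -> exists2 h', h < h' & u h' = u i.
  move=> ih uh.
  have [a [b [ab bV e]]] := repetition u h.
  exists (h + (b - a)%N%:Z); first lia.
  rewrite -uh.
  have -> : u (h + (b - a)%N%:Z) = reverse u (- (h + b%:Z) + a%:Z).
    by rewrite /reverse; congr u; lia.
  have -> : u h = reverse u (- (h + a%:Z) + a%:Z) by rewrite /reverse; congr u; lia.
  apply/esym/not_branching_follow; last by rewrite /reverse !opprK.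
  by move=> s sa; apply: nB'; lia.
have far m : exists2 h, i + m%:Z <= h & u h = u i.
  elim: m => [|m [h ih uh]]; first by exists i => //; lia.
  have [|h' hh' uh'] := rec h _ uh; first lia.
  by exists h' => //; lia.
move: (pB); rewrite inE => /andP[+ _]; rewrite inE => /asboolP[j jp].
(* This occurrence of [u i] lies at or beyond [j], so the branching edge at [j] would settle it. *)
have [h ih uh] := far `|j - i|%N.
have /negP[] // : p \notin branching u by rewrite -jp; apply: nB uh _; lia.
Qed.

End Itinerary.

(** * Words of a transitive subshift *)

Section TransitiveShift.
Variable A : finType.
Implicit Types (x y : full_shift A) (X : subshift A) (i j : int) (n : nat).

Lemma tnth_block x i n (k : 'I_n) : tnth (block x i n) k = x (i + (k : nat)%:Z).
Proof. by rewrite tnth_mktuple. Qed.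

Lemma block_eqP x y i j n :
  block x i n = block y j n <->
  forall k, (k < n)%N -> x (i + k%:Z) = y (j + k%:Z).
Proof.
split=> [e k kn|e]; last by apply: eq_from_tnth => k; rewrite !tnth_block e.
by have := congr1 (fun w => tnth w (Ordinal kn)) e; rewrite !tnth_block.
Qed.

Lemma language_block X x i n : points X x -> language X (block x i n).
Proof. by move=> Xx; exists x, i; rewrite size_tuple. Qed.

Lemma block_words X x i n : points X x -> block x i n \in words X n.
Proof. by move=> Xx; rewrite inE; apply/asboolP/language_block. Qed.

Lemma mem_wordsP X n (w : n.-tuple A) :
  reflect (exists x i, points X x /\ w = block x i n) (w \in words X n).
Proof.
rewrite inE; apply: (iffP (asboolP _)) => -[x [i [Xx e]]]; exists x, i.
  by split=> //; apply: val_inj; rewrite /= e size_tuple.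
by rewrite e size_tuple.
Qed.

Lemma card_edges_complexity X x0 n :
  points X x0 -> (#|edges (fun i => block x0 i n)| <= complexity X n.+1)%N.
Proof.
move=> X0.
(* Prefix and suffix of an [n.+1]-word: every edge of the path is such a pair. *)
pose ends (w : n.+1.-tuple A) : n.-tuple A * n.-tuple A :=
  ([tuple tnth w (widen_ord (leqnSn n) k) | k < n],
   [tuple tnth w (lift ord0 k) | k < n]).
apply: leq_trans (leq_imset_card ends _).
apply/subset_leq_card/fintype.subsetP => p; rewrite inE => /asboolP[i <-].
apply/imsetP; exists (block x0 i n.+1); first exact: block_words.
congr pair; apply: eq_from_tnth => k; rewrite !tnth_mktuple //=.
by rewrite /bump leq0n; congr x0; lia.
Qed.

Lemma nbhs_cylinder x i n :
  nbhs x [set y : full_shift A | block y i n = block x i n]%classic.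
Proof.
suff : nbhs x [set y : full_shift A |
    forall k, (k < n)%N -> y (i + k%:Z) = x (i + k%:Z)]%classic.
  by apply: filterS => y yx; apply/block_eqP.
elim: n => [|n IHn]; first by apply: filterS filterT => y _ k.
have xn : nbhs x [set y : full_shift A | y (i + n%:Z) = x (i + n%:Z)]%classic.
  exact: (@proj_continuous _ (fun _ : int => discrete_topology A) (i + n%:Z) x _
    (discrete_set1 _)).
apply: filterS (filterI IHn xn) => y [yx yn] k.
by rewrite ltnS leq_eqVlt => /predU1P[->|/yx].
Qed.

Section Transitive.
Variables (X : subshift A) (x0 : full_shift A).
Hypothesis X_closure : points X = closure (shift_orbit x0).

Lemma block_occurs x i n :
  points X x -> exists j, block x i n = block x0 j n.
Proof.
rewrite X_closure => /(_ _ (nbhs_cylinder x i n))[_ [[k _ <-]] /= e].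
exists (i + k); rewrite -e; apply/block_eqP => m _.
by rewrite /shiftz addrAC.
Qed.

Lemma words_verts n : points X x0 -> words X n = verts (fun i => block x0 i n).
Proof.
move=> X0; apply/setP => w; apply/mem_wordsP/idP => [[x [i [Xx ->]]]|].
  by have [j ->] := block_occurs i n Xx; exact: verts_mem.
by rewrite inE => /asboolP[i <-]; exists x0, i.
Qed.

(** Periodicity is visible in words of length [P.+1], so it passes from [x0] to all of [X]; a
    [P]-periodic point is then fixed by [P] letters. *)
Lemma periodic_finite P :
  (0 < P)%N -> (forall i, x0 (i + P%:Z) = x0 i) -> finite_set X.
Proof.
move=> P0 per.
have perX x i : points X x -> x (i + P%:Z) = x i.
  move=> /(block_occurs i P.+1)[j /block_eqP e].
  by rewrite (e P) // per -[j]addr0 -[i in RHS]addr0 (e 0%N).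
pose unroll (w : {ffun 'I_P -> A}) : full_shift A :=
  fun i => w (Ordinal (ltn_pmod `|(i %% P)%Z| P0)).
apply: (@sub_finite_set _ _ (range unroll)); last exact/finite_image/finite_finset.
move=> x Xx; exists [ffun k : 'I_P => x (k : nat)%:Z] => //.
apply/funext => i; rewrite /unroll ffunE /=.
have perM (m : nat) j : x (j + (m * P)%N%:Z) = x j.
  elim: m => [|m IHm]; first by rewrite mul0n addr0.
  by rewrite mulSn -{}IHm -[RHS]perX //; congr x; lia.
have r0 : 0 <= (i %% P)%Z by apply: modz_ge0; lia.
have rP : ((i %% P)%Z < P%:Z) by apply: ltz_pmod; lia.
have -> : (`|(i %% P)%Z| %% P)%N%:Z = (i %% P)%Z by rewrite modn_small; lia.
have := divz_eq i P; move: (i %% P)%Z => r.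
case: (i %/ P)%Z => m ->; first by rewrite addrC -PoszM perM.
rewrite -[RHS](perM m.+1); congr x.
by rewrite NegzE PoszM mulNr addrAC addNr add0r.
Qed.

End Transitive.

Lemma card_alphabet_gt1 X : infinite_set X -> (1 < #|A|)%N.
Proof.
move=> Xinf; rewrite ltnNge; apply/negP => /fintype.card_le1_eqP A1; apply: Xinf.
have [x0|noX] := pselect (exists x, points X x); last first.
  by apply: (@sub_finite_set _ _ set0) => // x Xx; case: noX; exists x.
have [x Xx] := x0; apply: (@sub_finite_set _ _ [set x]%classic) => // y _.
by apply/funext => i; exact: A1.
Qed.

End TransitiveShift.

(** * Encoding automorphisms by finitely many sample words *)

Lemma card_le_finType (T : Type) (I : finType) (D : set T) (f : T -> I)
    (R : {pred I}) (m : nat) :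
  (#|R| <= m)%N -> {in D &, injective f} ->
  (forall x, D x -> f x \in R) -> (D #<= `I_m)%card.
Proof.
move=> Rm f_inj fR.
pose g x := index (f x) (enum R).
have g_inj : {in D &, injective g}.
  move=> x y xD yD /(congr1 (nth (f x) (enum R))).
  rewrite !nth_index ?mem_enum ?fR //; try exact/set_mem.
  exact: f_inj.
move: (inj_card_eq g_inj); rewrite card_eq_sym => /card_le_eql ->.
apply: subset_card_le => _ [x Dx <-] /=.
by apply: leq_trans Rm; rewrite cardE index_mem mem_enum fR.
Qed.

Theorem corollary3p1 (A : finType) (X : subshift A)
  (X_infinite : infinite_set X) (X_transitive : topologically_transitive X)
  (n : nat) (n_ge1 : (1 <= n)%N) :
  (AutN X ((n - 1)./2) #<=
    `I_(complexity X (1 + complexity X n)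
        ^ (2 * #|A| * (complexity X (n + 1) - complexity X n))))%card.
Proof.
have [x0 X0 X_closure] := X_transitive.
pose N := (n - 1)./2; pose c := complexity X n.
have Nn : (2 * N + 1 <= n)%N by rewrite /N; lia.
pose u i := block x0 i n.
have cE : c = #|verts u| by rewrite /c /complexity (words_verts X_closure n X0).
(* The implication sits under the quantifier so that [choice] yields a total function, with value
   irrelevant off [branching w]. *)
have ex_step (w : int -> n.-tuple A) p : exists i, p \in branching w -> step w i = p.
  have [pw|] := boolP (p \in branching w); last by exists 0.
  by move: pw; rewrite inE => /andP[]; rewrite inE => /asboolP[i <-]; exists i.
have [k kP] := choice (ex_step u).
have [l lP] := choice (ex_step (reverse u)).
have nper : ~ exists2 P, (0 < P)%N & forall i, u (i + P%:Z) = u i.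
  move=> [P P0 per]; apply: X_infinite.
  apply: (periodic_finite X_closure P0) => i.
  by have /block_eqP/(_ 0%N n_ge1) := per i; rewrite !addr0.
have cover i := reach_from_either kP lP nper i.
pose x0' : X := exist _ x0 (mem_set X0).
(* The [n]-word at [i] determines the output at [i + N]. The windows thus cover the outputs of
   [u (k p + s)], respectively [u (- (l p + s))], for [0 <= s <= c]. *)
pose sample (phi : X -> X) (e : n.-tuple A * n.-tuple A + n.-tuple A * n.-tuple A) :=
  match e with
  | inl p => block (val (phi x0')) (k p + N%:Z) (1 + c)
  | inr p => block (val (phi x0')) (- (l p + c%:Z) + N%:Z) (1 + c)
  end.
pose D := [pred e | match e with inl p => p \in branching u
                               | inr p => p \in branching (reverse u) end].
pose y0 := block x0 0 (1 + c).
(* The constant [y0] off [D] makes the number of codes at most the number of words to the power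
   [#|D|]. *)
pose code phi := [ffun e => if e \in D then sample phi e else y0].
apply: (@card_le_finType _ _ _ code (pffun_on y0 D (mem (words X (1 + c))))).
- rewrite card_pffun_on.
  apply: leq_pexp2l.
    by apply/card_gt0P; exists y0; exact: block_words.
  have -> : #|D| = (#|branching u| + #|branching (reverse u)|)%N.
    by rewrite -!sum1_card big_sumType.
  have A2 := card_alphabet_gt1 X_infinite.
  have := card_branching u; have := card_branching (reverse u).
  rewrite verts_reverse card_edges_reverse -cE.
  have := card_edges_complexity n X0; rewrite -/u -addn1 -/c => le1 le2 le3.
  (* Two kinds of branching edges with a factor 2 each; then [4 <= 2 * #|A|]. *)
  apply: (@leq_trans (4 * (complexity X (n + 1) - c))); first lia.
  by rewrite leq_mul2r; apply/orP; right; lia.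
- move=> phi psi /set_mem[_ [Phi PhiP]] /set_mem[_ [Psi PsiP]] code_eq.
  have im_eq e : e \in D -> sample phi e = sample psi e.
    by move=> eD; have := congr1 (fun f : {ffun _} => f e) code_eq; rewrite !ffunE eD.
  have local (f : X -> X) : has_range N f ->
      forall (x y : X) i j, block (val x) i n = block (val y) j n ->
      val (f x) (i + N%:Z) = val (f y) (j + N%:Z).
    move=> [F FP] x y i j /block_eqP e; rewrite !FP !addrK; congr F.
    by apply/block_eqP => m mN; apply: e; lia.
  have phiN : has_range N phi by exists Phi.
  have psiN : has_range N psi by exists Psi.
  have agree0 i : val (phi x0') (i + N%:Z) = val (psi x0') (i + N%:Z).
    have [[p pB [s sV us]]|[p pB [s sV us]]] := cover i.
      rewrite (local _ phiN x0' x0' _ _ us) (local _ psiN x0' x0' _ _ us).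
      have /block_eqP/(_ s) := im_eq (inl p) pB.
      by rewrite addrAC; apply; rewrite cE; lia.
    rewrite (local _ phiN x0' x0' _ _ us) (local _ psiN x0' x0' _ _ us).
    (* The backward window is read from its left end, so [s] steps back sits at index [c - s]. *)
    have /block_eqP/(_ (c - s)%N) := im_eq (inr p) pB.
    have -> : - (l p + c%:Z) + N%:Z + (c - s)%N%:Z = - (l p + s%:Z) + N%:Z by lia.
    by apply; lia.
  (* Agreement on [x0] extends to any [x], since every [n]-word of [x] occurs in [x0]. *)
  apply/funext => x; apply: val_inj; apply/funext => i.
  rewrite -[i](subrK N%:Z).
  have [j xj] := block_occurs X_closure (i - N%:Z) n (set_valP x).
  by rewrite (local _ phiN x x0' _ _ xj) (local _ psiN x x0' _ _ xj).
- move=> phi _; apply/pffun_onP; split.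
    apply/fintype.subsetP => e; rewrite inE ffunE; case: ifP => //.
    by rewrite eqxx.
  move=> _ /fintype.imageP[e eD ->]; rewrite ffunE eD.
  by case: e {eD} => p; apply: block_words; exact: set_valP.
Qed.
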